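(* Let $E$ be a nonempty subset of a Hilbert space $(X,|\cdot|)$, and let $f:E\to\mathbb{R}$, $G:E\to X$ be two functions. There exists $F\in C^{1,\omega}(X)$ such that $(F,\nabla F)=(f,G)$ on $E$ if and only if $(f,G)$ satisfies condition $(mg^{1,\omega})$ on $E$ for some $M>0$, that is, $$f(y)+\langle G(y),x-y\rangle+M\varphi(|x-y|)\ \ge\ f(z)+\langle G(z),x-z\rangle-M\varphi(|x-z|)\quad\text{for all } y,z\in E,\ x\in X.$$ Moreover, if $(f,G)$ satisfies $(mg^{1,\omega})$ with constant $M>0$, then $F$ can be chosen so that $M_\omega(\nabla F)\le\frac{16}{\sqrt{15}}\,M$.
   Context: Spaces are real. $\omega:[0,\infty)\to[0,\infty)$ is a modulus of continuity: a concave, increasing, continuous function with $\omega(0)=0$ and $\lim_{t\to\infty}\omega(t)=\infty$. Put $\varphi(t)=\int_0^t\omega(s)\,ds$ for $t\ge0$. The dual of a Hilbert space $X$ is identified with $X$. $C^{1,\omega}(X)$ is the set of Fréchet differentiable $g:X\to\mathbb{R}$ for which there is a constant $C>0$ with $|\nabla g(x)-\nabla g(y)|\le C\,\omega(|x-y|)$ for all $x,y\in X$. For a map $H:D\to X$, $D\subseteq X$, $M_\omega(H)=\sup_{x,y\in D,\,x\ne y}\frac{|H(x)-H(y)|}{\omega(|x-y|)}$. *)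

(* Defs.v *)
From HB Require Import structures.
From mathcomp Require Import all_boot all_order all_algebra.
From mathcomp Require Import sesquilinear.
From mathcomp Require Import all_classical all_reals all_analysis.
Import Order.TTheory GRing.Theory Num.Theory.
Import numFieldNormedType.Exports.

Set Implicit Arguments.
Unset Strict Implicit.
Unset Printing Implicit Defensive.

Local Open Scope classical_set_scope.
Local Open Scope ring_scope.

HB.mixin Record CompleteNormedModule_isHilbert (R : realType) X
    of CompleteNormedModule R X := {
  inner : {dot X for @idfun R};
  inner_normE : forall x : X, inner x x = `|x| ^+ 2
}.

#[short(type="hilbertType")]
HB.structure Definition Hilbert (R : realType) :=
  {X of CompleteNormedModule_isHilbert R X & CompleteNormedModule R X}.

(* A function on [0, +oo[ is a total function R -> R of which only the values
   on [0, +oo[ matter. *)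
Record modulus_of_continuity (R : realType) (omega : R -> R) : Prop := {
  modulus_ge0 : forall t, 0 <= t -> 0 <= omega t ;
  modulus_concave : convex_function (`[0, +oo[%classic : set R) (\- omega) ;
  modulus_increasing :
    {in `[0, +oo[ &, {homo omega : s t / s <= t}} ;
  modulus_continuous : {within `[0, +oo[, continuous omega} ;
  modulus0 : omega 0 = 0 ;
  modulus_pinfty : omega t @[t --> +oo] --> +oo }.

Definition phi (R : realType) (omega : R -> R) (t : R) : R :=
  \int[lebesgue_measure]_(s in `[0, t]) omega s.

Section C1omega.
Context {R : realType} {X : hilbertType R}.

(* The vector that represents the Frechet differential of g at x under the
   identification of X with its dual; like 'd g x, a junk value where g is not
   differentiable. *)
Definition grad (g : X -> R) (x : X) : X :=
  xget 0 [set v | forall h, 'd g x h = inner v h].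

Definition C1omega (omega : R -> R) (g : X -> R) : Prop :=
  (forall x, differentiable g x) /\
  exists2 C : R, 0 < C &
    forall x y, `|grad g x - grad g y| <= C * omega `|x - y|.

(* The supremum is taken in \bar R; over an empty family (D has at most one
   point) it is -oo. *)
Definition Momega (omega : R -> R) (D : set X) (H : X -> X) : \bar R :=
  ereal_sup [set (`|H p.1 - H p.2| / omega `|p.1 - p.2|)%:E
    | p in [set p : X * X | [/\ D p.1, D p.2 & p.1 != p.2]]].

Definition mg1omega (omega : R -> R) (M : R) (E : set X)
    (f : X -> R) (G : X -> X) : Prop :=
  forall y z x, E y -> E z ->
    f y + inner (G y) (x - y) + M * phi omega `|x - y| >=
    f z + inner (G z) (x - z) - M * phi omega `|x - z|.

End C1omega.

(* Main.v *)
Require Import Defs.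
From HB Require Import structures.
From mathcomp Require Import all_boot all_order all_algebra.
From mathcomp Require Import sesquilinear.
From mathcomp Require Import all_classical all_reals all_analysis.
From mathcomp Require Import ring lra.
Import Order.TTheory GRing.Theory Num.Theory.
Import numFieldNormedType.Exports.

(** Necessity is Taylor's formula: along a segment, an [omega]-continuous
    gradient with constant [C] gives
    [|F (x + v) - F x - <grad F x, v>| <= C * phi |v|], so [F x] lies between
    the two sides of the condition with [M = C]
    ([C1omega_taylor]).

    Sufficiency. Put [theta t = 4 * phi (t / 2)]. Since
    [s |-> phi (sqrt s)] is concave, [phi |.|] has at every point a first-order
    upper expansion with error [theta] ([phi_norm_taylor]). Hence the functions
    [upper y = f y + <G y, . - y> + M * phi |. - y|] are concave, and the
    functions [lower z = f z + <G z, . - z> - M * phi |. - z|] convex, up to an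
    error [M * theta] in Jensen's inequality; the condition says that
    every [lower z] is below every [upper y].

    Let [F] be the largest almost convex function below all the [upper y]
    ([almost_convex_sandwich]). It lies above every [lower z]. It is also almost
    concave: the class of almost convex functions is stable under
    translations and averages, and an average of translates of [F], minus the
    error, is still below each [upper y] because [upper y] is almost concave;
    so it is below [F] by maximality.

    A function that is affine up to [M * theta] in Jensen's inequality, and
    bounded above near each point, has difference quotients that converge at
    a controlled rate to a bounded linear form, which Riesz' theorem represents
    by a vector: [F] is differentiable with Taylor error [M * theta]
    ([taylor_of_almost_affine]). On [E] the squeeze
    [lower y <= F <= upper y] determines the value and the gradient.

    Comparing the Taylor expansions at [x] and [y] in two points that are
    symmetric about their midpoint bounds [grad F x - grad F y]; the distance
    [sqrt 15 / 2 * |x - y|] of these points from the midpoint yields the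
    constant [16 / sqrt 15] ([taylor_lipschitz]). *)

Set Implicit Arguments.
Unset Strict Implicit.
Unset Printing Implicit Defensive.

Local Open Scope classical_set_scope.
Local Open Scope ring_scope.

(** * Inner product *)

Section inner_product.
Context {R : realType} {X : hilbertType R}.
Implicit Types x y z : X.

Lemma innerC x y : inner x y = inner y x.
Proof. by rewrite hermC/= expr0 mul1r. Qed.

Lemma innerDl x y z : inner (x + y) z = inner x z + inner y z.
Proof. exact: linearDl. Qed.

Lemma innerDr x y z : inner x (y + z) = inner x y + inner x z.
Proof. exact: linearDr. Qed.

Lemma innerBl x y z : inner (x - y) z = inner x z - inner y z.
Proof. exact: linearBl. Qed.

Lemma innerBr x y z : inner x (y - z) = inner x y - inner x z.
Proof. exact: linearBr. Qed.

Lemma innerNr x y : inner x (- y) = - inner x y.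
Proof. exact: linearNr. Qed.

Lemma innerZl a x y : inner (a *: x) y = a * inner x y.
Proof. exact: linearZl_LR. Qed.

Lemma innerZr a x y : inner x (a *: y) = a * inner x y.
Proof. exact: linearZr_LR. Qed.

Lemma inner0r x : inner x 0 = 0.
Proof. exact: linear0r. Qed.

Lemma sqr_normD x y : `|x + y| ^+ 2 = `|x| ^+ 2 + 2 * inner x y + `|y| ^+ 2.
Proof.
by rewrite -!inner_normE innerDl !innerDr (innerC y x); ring.
Qed.

Lemma sqr_normB x y : `|x - y| ^+ 2 = `|x| ^+ 2 - 2 * inner x y + `|y| ^+ 2.
Proof.
by rewrite -!inner_normE innerBl !innerBr (innerC y x); ring.
Qed.

Lemma parallelogram x y :
  `|x + y| ^+ 2 + `|x - y| ^+ 2 = 2 * (`|x| ^+ 2 + `|y| ^+ 2).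
Proof. by rewrite sqr_normD sqr_normB; ring. Qed.

Lemma cauchy_schwarz x y : inner x y <= `|x| * `|y|.
Proof.
have : `|x + y| ^+ 2 <= (`|x| + `|y|) ^+ 2.
  by rewrite ler_sqr ?nnegrE ?addr_ge0// ler_normD.
rewrite sqr_normD => h; nra.
Qed.

Lemma cauchy_schwarz_abs x y : `|inner x y| <= `|x| * `|y|.
Proof.
rewrite ler_norml cauchy_schwarz andbT lerNl -innerC.
have := cauchy_schwarz (- y) x.
by rewrite -scaleN1r innerZl mulN1r scaleN1r normrN mulrC.
Qed.

End inner_product.

(** * The modulus and its primitive *)

Lemma le_of_derive_ge0 (R : realType) (f df : R -> R) (a b : R) : a <= b ->
  (forall x : R, is_derive x (1 : R) f (df x)) ->
  (forall x, a <= x -> x <= b -> 0 <= df x) -> f a <= f b.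
Proof.
move=> ab fd df0; rewrite -subr_ge0.
have [] := @MVT_segment R f df a b ab (fun x _ => fd x).
  by apply: derivable_within_continuous => x _; exact: ex_derive.
move=> c; rewrite in_itv/= => /andP[ac cb] ->.
by rewrite mulr_ge0 ?df0// subr_ge0.
Qed.

Section modulus.
Context {R : realType} {omega : R -> R}.
Hypothesis homega : modulus_of_continuity omega.

Lemma modulus_le s t : 0 <= s -> s <= t -> omega s <= omega t.
Proof.
move=> s0 st; apply: (modulus_increasing homega) => //.
  by rewrite in_itv/= s0.
by rewrite in_itv/= (le_trans s0 st).
Qed.

Lemma modulus_conv l a b : 0 <= l -> l <= 1 -> 0 <= a -> 0 <= b ->
  l * omega a + (1 - l) * omega b <= omega (l * a + (1 - l) * b).
Proof.
move=> l0 l1 a0 b0.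
have := modulus_concave homega (Itv01 l0 l1) (x := a) (y := b).
rewrite !inE/= !in_itv/= !andbT => /(_ a0 b0).
rewrite [leRHS]convRE /conv/= /unstable.onem !mulrN -opprD lerN2.
exact.
Qed.

(** The ratio [omega t / t] is nonincreasing: the graph of a concave function
    that starts at the origin lies above its chords from the origin. *)
Lemma modulus_ratio s t : 0 <= s -> s <= t -> s * omega t <= t * omega s.
Proof.
move=> s0 st; have [->|t0] := eqVneq t 0.
  by rewrite (modulus0 homega) mulr0 mul0r.
have {}t0 : 0 < t by rewrite lt_neqAle eq_sym t0 (le_trans s0 st).
have st1 : s / t <= 1 by rewrite ler_pdivrMr// mul1r.
have := modulus_conv (divr_ge0 s0 (ltW t0)) st1 (ltW t0) (lexx 0).
rewrite (modulus0 homega) !mulr0 !addr0 divfK ?gt_eqF// => h.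
have := ler_wpM2l (ltW t0) h.
by rewrite mulrA mulrCA divff ?gt_eqF// mulr1.
Qed.

Lemma modulus_midpoint a b : 0 <= a -> 0 <= b ->
  omega a + omega b <= 2 * omega ((a + b) / 2).
Proof.
move=> a0 b0; have h0 : (0 : R) <= 2^-1 by rewrite invr_ge0.
have h1 : (2^-1 : R) <= 1 by lra.
have := modulus_conv h0 h1 a0 b0.
rewrite (_ : 2^-1 * a + _ = (a + b) / 2); last by field.
lra.
Qed.

(* Extending [omega] by 0 to the left turns it into a continuous function on
   the line and makes [phi omega] differentiable everywhere, with no one-sided
   derivative at 0. *)
Let om (t : R) := omega (Num.max t 0).

Let om_continuous : continuous om.
Proof.
move=> x; rewrite /om.
have /subspace_continuousP/(_ (Num.max x 0)) := modulus_continuous homega.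
move=> /(_ ltac:(by rewrite /= in_itv/= le_max lexx orbT)) cw.
apply: cvg_trans cw => A /= hA.
have : \forall z \near x,
    (fun y => Num.max y 0) z \in `[0, +oo[ -> A (omega (Num.max z 0)).
  have mc : {for x, continuous (id \max cst 0 : R -> R)}.
    by apply: continuous_max; [exact: cvg_id|exact: cvg_cst].
  exact: mc _ hA.
by apply: filterS => z; apply; rewrite in_itv/= le_max lexx orbT.
Qed.

Let phi_om (N t : R) : 0 <= N ->
  phi omega t = \int[lebesgue_measure]_(s in `[- N, t]) om s.
Proof.
move=> N0; rewrite /phi [LHS]Rintegral_mkcond [RHS]Rintegral_mkcond.
congr Rintegral; apply/funext => s; rewrite !patchE /om.
have [s0|s0] := leP s 0; last first.
  by rewrite !mem_setE !in_itv/= (ltW s0) (le_trans _ (ltW s0)) ?oppr_le0.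
rewrite !mem_setE !in_itv/= (modulus0 homega) if_same.
case: ifP => // /andP[s0' _].
have -> : s = 0 by apply/eqP; rewrite eq_le s0 s0'.
by rewrite (modulus0 homega).
Qed.

Lemma phi_is_derive (t : R) :
  is_derive t (1 : R) (phi omega) (omega (Num.max t 0)).
Proof.
pose N := `|t| + 1.
have N0 : 0 <= N by rewrite addr_ge0.
have Nt : - N < t.
  by rewrite ltrNl (le_lt_trans (ler_norm _))// normrN ltrDl.
have [||//||d e] := @continuous_FTC1_closed R om (- N) t (t + 1).
- by rewrite ltrDl.
- apply: continuous_compact_integrable; first exact: segment_compact.
  exact: continuous_subspaceT.
- exact: om_continuous.
have E : (fun x => \int[lebesgue_measure]_(t in `[- N, x]) om t) = phi omega.
  by apply/funext => x; rewrite (phi_om x N0).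
rewrite E in d e.
by apply: DeriveDef => //; rewrite -derive1E.
Qed.

Lemma phi0 : phi omega 0 = 0.
Proof. by rewrite /phi set_itv1 Rintegral_set1. Qed.

Lemma phi_le s t : s <= t -> phi omega s <= phi omega t.
Proof.
move=> st; apply: (le_of_derive_ge0 st phi_is_derive) => x _ _.
by apply: (modulus_ge0 homega); rewrite le_max lexx orbT.
Qed.

Lemma phi_le_modulus t : 0 <= t -> phi omega t <= t * omega t.
Proof.
move=> t0.
have := @le_of_derive_ge0 R (fun x => x * omega t - phi omega x)
  (fun x => omega t - omega (Num.max x 0)) 0 t t0.
rewrite mul0r phi0 subrr subr_ge0; apply => [x|x x0 xt]; last first.
  by rewrite subr_ge0 max_l// modulus_le.
have := phi_is_derive x => ?.
apply: is_derive_eq; rewrite scaler0 add0r /GRing.scale/=; ring.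
Qed.

(** On [[0, t]] the graph of [omega] lies above its chord, so the area below it
    is at least that of the triangle. *)
Lemma phi_ge_modulus t : 0 <= t -> t * omega t <= 2 * phi omega t.
Proof.
move=> t0; have [->|tn0] := eqVneq t 0; first by rewrite mul0r phi0 mulr0.
have {}tn0 : 0 < t by rewrite lt_neqAle eq_sym tn0.
have := @le_of_derive_ge0 R (fun x => 2 * phi omega x - (omega t / t) * x ^+ 2)
  (fun x => 2 * omega (Num.max x 0) - (omega t / t) * (2 * x)) 0 t t0.
rewrite phi0 mulr0 expr0n mulr0 subrr subr_ge0 => h.
rewrite (_ : t * omega t = omega t / t * t ^+ 2); last by field; rewrite gt_eqF.
apply: h => [x|x x0 xt].
  have := phi_is_derive x => ?.
  by apply: is_derive_eq; rewrite /GRing.scale/=; ring.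
rewrite max_l// subr_ge0.
rewrite (_ : omega t / t * _ = 2 * (x * omega t / t)); last by ring.
by rewrite ler_pM2l// ler_pdivrMr// [leRHS]mulrC modulus_ratio.
Qed.

(** Concavity of [fun s => phi (sqrt s)], in the form of a supporting line at
    [s = r ^+ 2]: its derivative [omega (sqrt s) / (2 * sqrt s)] is
    nonincreasing. *)
Lemma phi_tangent_sqr r p : 0 < r -> 0 <= p ->
  phi omega p <= phi omega r + omega r / (2 * r) * (p ^+ 2 - r ^+ 2).
Proof.
move=> r0 p0.
pose h x := omega r / (2 * r) * x ^+ 2 - phi omega x.
pose dh x := omega r / r * x - omega (Num.max x 0).
have dhP (x : R) : is_derive x (1 : R) h (dh x).
  have := phi_is_derive x => ?.
  by apply: is_derive_eq; rewrite /GRing.scale/= /dh; field; rewrite gt_eqF.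
suff : h r <= h p by rewrite /h; lra.
have [pr|rp] := leP p r; last first.
  apply: (le_of_derive_ge0 (ltW rp) dhP) => x rx _.
  have x0 := lt_le_trans r0 rx.
  rewrite /dh max_l ?(ltW x0)// subr_ge0 mulrAC ler_pdivlMr// mulrC.
  by rewrite [leRHS]mulrC modulus_ratio// ltW.
rewrite -lerN2; have ndhP (x : R) : is_derive x (1 : R) (\- h) (- dh x).
  by have := dhP x => ?; exact: is_deriveN.
apply: (le_of_derive_ge0 pr ndhP) => x px xr.
have x0 := le_trans p0 px.
rewrite /dh opprB max_l// subr_ge0 mulrAC ler_pdivrMr// mulrC.
by rewrite [leRHS]mulrC modulus_ratio.
Qed.

(** At [s = r] the inequality is the triangle bound [phi_ge_modulus]; for
    larger [s], midpoint concavity of [omega] at [2 * s - r] and [r] compares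
    the derivatives in [s]. *)
Lemma phi_reflect r s : 0 <= r -> r <= s ->
  phi omega (2 * s - r) + 2 * s * omega r <= phi omega r + 4 * phi omega s.
Proof.
move=> r0 rs.
pose h x := 4 * phi omega x - phi omega (2 * x - r) - 2 * x * omega r.
pose dh x := 4 * omega (Num.max x 0) - 2 * omega (Num.max (2 * x - r) 0)
  - 2 * omega r.
have dhP (x : R) : is_derive x (1 : R) h (dh x).
  have := phi_is_derive x => ?.
  have l' : is_derive x (1 : R) (fun x : R => 2 * x - r) 2.
    by apply: is_derive_eq; rewrite /GRing.scale/=; ring.
  have := @is_derive1_comp R (phi omega) (fun x => 2 * x - r) x _ _
    (phi_is_derive (2 * x - r)) l' => ?.
  rewrite /h -[fun y => _]/(fun y : R => 4 * phi omega y
    - (phi omega \o (fun x => 2 * x - r)) y - 2 * y * omega r).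
  by apply: is_derive_eq; rewrite /GRing.scale/= /dh; ring.
have : h r <= h s.
  apply: (le_of_derive_ge0 rs dhP) => x rx xs; rewrite /dh.
  rewrite !max_l; [|lra|lra].
  have := @modulus_midpoint (2 * x - r) r.
  rewrite subrK mulrAC divff// mul1r => h'.
  by have := h' ltac:(lra) r0; lra.
rewrite /h (_ : 2 * r - r = r); last by ring.
have := phi_ge_modulus r0; lra.
Qed.

End modulus.

(** * The radial function and its first-order expansion *)

(** The primitive of [t |-> 2 * omega (t / 2)], which is the modulus of
    continuity of the gradient of [phi omega |.|]. *)
Definition theta (R : realType) (omega : R -> R) (t : R) : R :=
  4 * phi omega (t / 2).

Section taylor.
Context {R : realType} {X : hilbertType R} {omega : R -> R}.
Hypothesis homega : modulus_of_continuity omega.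

(** With [r = |x|], [t = |u|] and [xi = omega r / r * x]: for [t <= 2 * r] the
    supporting line of [s |-> phi (sqrt s)] at [r ^+ 2] costs
    [omega r / (2 * r) * t ^+ 2], which is at most [4 * phi (t / 2)]. For
    [t > 2 * r] one has [|x + u| >= t - r > r], and the supporting line at
    [(t - r) ^+ 2] reduces the claim to the collinear case [phi_reflect]. *)
Lemma phi_norm_taylor (x : X) : exists xi : X, forall u,
  phi omega `|x + u| <= phi omega `|x| + inner xi u + theta omega `|u|.
Proof.
have [->|x0] := eqVneq x 0.
  exists 0 => u; rewrite add0r normr0 innerC inner0r addr0.
  have := @phi_reflect R omega homega 0 (`|u| / 2) (lexx 0)
    ltac:(by rewrite divr_ge0).
  by rewrite subr0 (modulus0 homega) mulr0 addr0 mulrC divfK.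
have r0 : 0 < `|x| by rewrite normr_gt0.
exists ((omega `|x| / `|x|) *: x) => u; rewrite innerZl /theta.
set r := `|x| in r0 *; set c := inner x u; set t := `|u|.
have t0 : 0 <= t by exact: normr_ge0.
have sq : `|x + u| ^+ 2 = r ^+ 2 + 2 * c + t ^+ 2 by exact: sqr_normD.
have [tr|rt] := leP t (2 * r).
  have := phi_tangent_sqr homega r0 (normr_ge0 (x + u)).
  rewrite sq => /le_trans; apply.
  rewrite (_ : omega r / (2 * r) * _ =
               omega r / r * c + omega r / (2 * r) * t ^+ 2);
    last by field; rewrite gt_eqF.
  rewrite -addrA !lerD2l.
  have s0 : 0 <= t / 2 by rewrite divr_ge0.
  have sr : t / 2 <= r by lra.
  have := phi_ge_modulus homega s0; have := modulus_ratio homega s0 sr => h1 h2.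
  rewrite (_ : _ * t ^+ 2 = (t / 2) * (t / 2 * omega r) * 2 / r);
    last by field; rewrite gt_eqF.
  rewrite ler_pdivrMr//.
  have := ler_wpM2l s0 h1; nra.
have p0 : 0 < t - r by lra.
have := phi_tangent_sqr homega p0 (normr_ge0 (x + u)).
rewrite sq => /le_trans; apply.
have h := phi_reflect homega (ltW r0) (_ : r <= t / 2).
have {h} := h ltac:(lra).
rewrite (_ : 2 * (t / 2) = t); last by field.
have rp : r <= t - r by lra.
have q0 : 0 <= (r ^+ 2 + 2 * c + t ^+ 2) - (t - r) ^+ 2.
  have : - (r * t) <= c.
    have := cauchy_schwarz_abs x u; rewrite ler_norml => /andP[]//.
  by move=> ?; nra.
have : omega (t - r) / (2 * (t - r)) <= omega r / (2 * r).
  have := modulus_ratio homega (ltW r0) rp => h.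
  rewrite ler_pdivrMr ?mulr_gt0// mulrAC ler_pdivlMr ?mulr_gt0//.
  lra.
move=> /(ler_wpM2r q0) /[swap] h1 h2.
rewrite -lerBrDl; apply: (le_trans h2).
rewrite (_ : omega r / (2 * r) * _ = omega r / r * c + omega r * t);
    last by field; rewrite gt_eqF.
lra.
Qed.

End taylor.

(** * Almost convex functions *)

Section almost_convex.
Context {R : realType} {X : hilbertType R}.

(** Jensen's inequality for two points, up to an error that depends on their
    distances to the barycentre. *)
Definition almost_convex (e : R -> R) (h : X -> R) :=
  forall l x u v, 0 <= l -> l <= 1 -> l *: u + (1 - l) *: v = 0 ->
  h x <= l * h (x + u) + (1 - l) * h (x + v) + (l * e `|u| + (1 - l) * e `|v|).

Lemma subgradient_almost_convex (e : R -> R) (h : X -> R) :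
  (forall x, exists xi : X, forall u, h x + inner xi u - e `|u| <= h (x + u)) ->
  almost_convex e h.
Proof.
move=> hh l x u v l0 l1 uv; have [xi hxi] := hh x.
have := ler_wpM2l l0 (hxi u).
have := @ler_wpM2l _ (1 - l) ltac:(by rewrite subr_ge0) _ _ (hxi v).
have : l * inner xi u + (1 - l) * inner xi v = 0.
  by rewrite -!innerZr -innerDr uv inner0r.
lra.
Qed.

(** [F] is the supremum of all almost convex functions below [Q], which makes it
    almost convex. For fixed weights and displacements, the average of two
    translates of [F] minus the error is again such a function: below [Q]
    because [Q] is almost concave. Maximality puts it below [F], which says that
    [F] is almost concave. *)
Lemma almost_convex_sandwich (e : R -> R) (P Q : set (X -> R)) :
  P !=set0 -> Q !=set0 ->
  (forall p q x, P p -> Q q -> p x <= q x) ->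
  (forall p, P p -> almost_convex e p) ->
  (forall q, Q q -> almost_convex e (\- q)) ->
  exists F : X -> R,
    [/\ almost_convex e F, almost_convex e (\- F),
        forall p x, P p -> p x <= F x & forall q x, Q q -> F x <= q x].
Proof.
move=> [p0 Pp0] [q0 Qq0] PQ cP cQ.
pose S := [set h : X -> R | almost_convex e h /\ forall q x, Q q -> h x <= q x].
have PS p : P p -> S p by move=> Pp; split; [exact: cP|move=> q x; exact: PQ].
pose V x := [set h x | h in S].
have V0 x : V x !=set0 by exists (p0 x), p0 => //; exact: PS.
pose F x := sup (V x).
have SF h x : S h -> h x <= F x.
  move=> Sh; apply: ub_le_sup; last by exists h.
  by exists (q0 x) => _ [k [_ kq] <-]; exact: kq.
have Fle x c : (forall h, S h -> h x <= c) -> F x <= c.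
  by move=> hc; apply: ge_sup => // _ [h Sh <-]; exact: hc.
have FQ q x : Q q -> F x <= q x by move=> Qq; apply: Fle => h [_]; exact.
have cF : almost_convex e F.
  move=> l x u v l0 l1 uv; apply: Fle => h Sh.
  apply: (le_trans (Sh.1 l x u v l0 l1 uv)); rewrite lerD2r.
  by rewrite lerD// ler_wpM2l ?subr_ge0// SF.
exists F; split => // [|p x Pp]; last exact/SF/PS.
move=> l x u v l0 l1 uv.
pose k y :=
  l * F (y + u) + (1 - l) * F (y + v) - (l * e `|u| + (1 - l) * e `|v|).
suff : k x <= F x by rewrite /k /=; lra.
have l1' : 0 <= 1 - l by rewrite subr_ge0.
apply: SF; split=> [l' y u' v' l'0 l'1 uv'|q y Qq]; last first.
  have := cQ q Qq l y u v l0 l1 uv => /=.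
  have := ler_wpM2l l0 (FQ q (y + u) Qq).
  have := ler_wpM2l l1' (FQ q (y + v) Qq).
  rewrite /k; lra.
have := ler_wpM2l l0 (cF l' (y + u) u' v' l'0 l'1 uv').
have := ler_wpM2l l1' (cF l' (y + v) u' v' l'0 l'1 uv').
rewrite /k ![y + u' + _]addrAC ![y + v' + _]addrAC; nra.
Qed.

End almost_convex.

(** * Riesz representation *)

Section riesz.
Context {R : realType} {X : hilbertType R}.

(** A minimising sequence of [|x| ^+ 2 - 2 * L x] is Cauchy by the parallelogram
    law, and its limit satisfies the Euler equation [inner l h = L h]. *)
Lemma riesz (L : X -> R) (C : R) :
  (forall u v, L (u + v) = L u + L v) -> (forall c u, L (c *: u) = c * L u) ->
  (forall u, L u <= C * `|u|) -> exists l : X, forall h, L h = inner l h.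
Proof.
move=> LD LZ LC.
pose J x := `|x| ^+ 2 - 2 * L x.
have J_lb : has_inf (range J).
  split; first by exists (J 0), 0.
  exists (- C ^+ 2) => _ [x _ <-]; rewrite /J.
  have := LC x; have := sqr_ge0 (`|x| - C); nra.
pose d := inf (range J).
have dJ x : d <= J x by apply: ge_inf; [exact: J_lb.2|exists x].
pose eps (n : nat) : R := n.+1%:R^-1.
have eps0 n : 0 < eps n by rewrite invr_gt0.
have xP n : exists x, J x < d + eps n.
  by have [_ [x _ <-] ?] := inf_adherent (eps0 n) J_lb; exists x.
have [x_ Jx] := choice xP.
have Jmid x y : `|x - y| ^+ 2 + 4 * J (2^-1 *: (x + y)) = 2 * J x + 2 * J y.
  rewrite /J LZ LD normrZ ger0_norm ?invr_ge0// exprMn.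
  have := parallelogram x y; lra.
have x_close m n : `|x_ m - x_ n| ^+ 2 <= 2 * (eps m + eps n).
  have := Jmid (x_ m) (x_ n); have := dJ (2^-1 *: (x_ m + x_ n)).
  have := Jx m; have := Jx n; lra.
have eps_small (e : R) : 0 < e -> \forall n \near \oo, eps n < e.
  by move=> ?; exact: near_infty_natSinv_lt (PosNum _).
have : cvg (x_ @ \oo).
  apply/cauchy_cvgP/cauchy_exP => e e0.
  have [N _ HN] := eps_small (e ^+ 2 / 4)
    ltac:(by rewrite divr_gt0// exprn_gt0).
  exists (x_ N), N => // n Nn; rewrite -ball_normE/=.
  rewrite -(ltr_pXn2r (n := 2))// ?nnegrE ?(ltW e0)//.
  apply: (le_lt_trans (x_close _ _)).
  have := HN N (leqnn _); have := HN n Nn; lra.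
move=> /cvg_ex[l xl]; exists l => h.
apply/eqP; rewrite -subr_eq0 -normr_le0.
apply/ler_addgt0Pr => e e0; rewrite add0r.
pose K := `|h| ^+ 2 + 1.
have K0 : 0 < K by rewrite ltr_wpDl ?sqr_ge0.
pose de := e / (`|h| + 1).
have de0 : 0 < de by rewrite divr_gt0// ltr_wpDl.
near \oo => n.
have xn : `|l - x_ n| <= de.
  by near: n; apply: (cvgr_dist_le _ _ xl).
have epsn : eps n < de ^+ 2 / K.
  by near: n; apply: eps_small; rewrite divr_gt0// exprn_gt0.
pose a := inner (x_ n) h - L h.
(* Up to the summand 1 of [K], which keeps [K] positive at [h = 0], this [t]
   minimises [J (x_ n + t *: h)]. *)
pose t := - a / K.
have Jt : J (x_ n + t *: h) = J (x_ n) + 2 * t * a + t ^+ 2 * `|h| ^+ 2.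
  rewrite /J sqr_normD LD LZ innerZr normrZ exprMn real_normK ?num_real// /a.
  ring.
have a2 : a ^+ 2 <= eps n * K.
  have := dJ (x_ n + t *: h); rewrite Jt => h1.
  have h2 := Jx n.
  have : - (2 * t * a + t ^+ 2 * `|h| ^+ 2) <= eps n by lra.
  rewrite (_ : - _ = (a ^+ 2 + a ^+ 2 / K) / K); last first.
    by rewrite /t /K; field; rewrite gt_eqF.
  rewrite ler_pdivrMr//; apply: le_trans.
  by rewrite lerDl divr_ge0 ?sqr_ge0// ltW.
have ade : `|a| <= de.
  rewrite -(ler_pXn2r (n := 2))// ?nnegrE ?(ltW de0)// real_normK ?num_real//.
  by rewrite (le_trans a2)// -ler_pdivlMr// ltW.
rewrite (_ : L h - inner l h = - (a + inner (l - x_ n) h)); last first.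
  by rewrite /a innerBl; ring.
rewrite normrN (le_trans (ler_normD _ _))//.
rewrite (_ : e = de + de * `|h|); last first.
  by rewrite /de; field; rewrite gt_eqF// ltr_wpDl.
rewrite lerD// (le_trans (cauchy_schwarz_abs _ _))// ler_wpM2r//.
Unshelve. all: by end_near. Qed.

End riesz.

(** * Differentiability of almost affine functions *)

Section differentiability.
Context {R : realType} {X : hilbertType R} (e : R -> R).
Hypothesis e0 : e 0 = 0.
Hypothesis e_le : forall s t : R, 0 <= s -> s <= t -> e s <= e t.
Hypothesis e_small : forall eps : R, 0 < eps ->
  exists2 d : R, 0 < d & forall t, 0 <= t -> t <= d -> e t <= eps * t.

Let e_ge0 t : 0 <= t -> 0 <= e t.
Proof. by move=> t0; rewrite -e0 e_le. Qed.

Lemma small_ray (a eps : R) : 0 <= a -> 0 < eps ->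
  \forall t \near 0^'+, e (t * a) / t <= eps.
Proof.
move=> a0 eps0; have a1 : 0 < a + 1 by rewrite ltr_wpDl.
have [d d0 hd] := e_small (divr_gt0 eps0 a1).
near=> t.
have t0 : 0 < t by near: t; exact: nbhs_right_gt.
have td : t <= d / (a + 1) by near: t; apply: nbhs_right_le; rewrite divr_gt0.
rewrite ler_pdivrMr//.
have := hd (t * a) (mulr_ge0 (ltW t0) a0).
rewrite ler_pdivlMr// in td.
have tad : t * a <= d by nra.
move=> /(_ tad) /le_trans; apply.
rewrite (_ : eps / (a + 1) * (t * a) = eps * t * (a / (a + 1))); last by ring.
rewrite ler_piMr ?mulr_ge0 ?ltW// ltr_pdivrMr// mul1r ltrDl//.
Unshelve. all: by end_near. Qed.

Context (F : X -> R) (x : X).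
Hypothesis F_cvx : almost_convex e F.
Hypothesis F_ccv : almost_convex e (\- F).
Hypothesis F_bound : exists K, forall v, `|v| <= 1 -> F (x + v) <= K.

Let quot (t : R) (v : X) := (F (x + t *: v) - F x) / t.
Let err (t : R) (v : X) := e (t * `|v|) / t.
Let L (v : X) := sup [set quot t v - err t v | t in [set t | 0 < t]].

(* For [s <= t] the point [x + s *: v] is the barycentre of [x + t *: v] and
   [x] with weights [s / t] and [1 - s / t]. *)
Let quot_dist_le (s t : R) v : 0 < s -> s <= t ->
  `|quot s v - quot t v| <= err s v + err t v.
Proof.
move=> s0 st; have t0 := lt_le_trans s0 st.
have l0 : 0 <= s / t by rewrite divr_ge0// ltW.
have l1 : s / t <= 1 by rewrite ler_pdivrMr// mul1r.
have uv : (s / t) *: ((t - s) *: v) + (1 - s / t) *: ((- s) *: v) = 0.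
  rewrite !scalerA -scalerDl (_ : s / t * (t - s) + _ = 0) ?scale0r//.
  by field; rewrite gt_eqF.
have := F_cvx (x + s *: v) l0 l1 uv; have := F_ccv (x + s *: v) l0 l1 uv.
rewrite -!addrA -!scalerDl addrN scale0r addr0 (addrC s) subrK /=.
rewrite !normrZ normrN (gtr0_norm s0) ger0_norm ?subr_ge0//.
have : s / t * e ((t - s) * `|v|) + (1 - s / t) * e (s * `|v|) <=
       s * (err s v + err t v).
  rewrite /err mulrDr mulrCA divff ?gt_eqF// mulr1 addrC lerD//.
    rewrite ler_piMl//; last by lra.
    by rewrite e_ge0// mulr_ge0// ltW.
  rewrite mulrCA (mulrC (e _)) ler_wpM2l// e_le ?mulr_ge0 ?subr_ge0//.
  by rewrite ler_wpM2r// gerBl ltW.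
move=> h1 h2 h3.
rewrite -(ler_pM2l s0) -{1}(gtr0_norm s0) -normrM.
rewrite (_ : s * (quot s v - quot t v) = F (x + s *: v)
   - (s / t * F (x + t *: v) + (1 - s / t) * F x)); last first.
  by rewrite /quot; field; rewrite !gt_eqF.
by rewrite ler_norml; apply/andP; split; lra.
Qed.

Let quot_dist (s t : R) v : 0 < s -> 0 < t ->
  `|quot s v - quot t v| <= err s v + err t v.
Proof.
move=> s0 t0; have [st|ts] := leP s t; first exact: quot_dist_le.
by rewrite distrC (addrC (err s v)) quot_dist_le// ltW.
Qed.

(* The intervals of radius [err t v] around [quot t v] meet pairwise, hence
   have a common point. *)
Let L_quot t v : 0 < t -> `|L v - quot t v| <= err t v.
Proof.
move=> t0; pose S := [set quot t v - err t v | t in [set t | 0 < t]].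
have ubS s : 0 < s -> ubound S (quot s v + err s v).
  move=> s0 _ [r /= r0 <-].
  by have := quot_dist v r0 s0; rewrite ler_norml => /andP[_]; lra.
have S0 : S !=set0.
  by exists (quot 1 v - err 1 v); exists 1 => //=; exact: ltr01.
rewrite ler_norml; apply/andP; split.
  have : quot t v - err t v <= L v.
    apply: ub_le_sup; last by exists t.
    by exists (quot 1 v + err 1 v); exact: ubS.
  lra.
have : L v <= quot t v + err t v by apply: ge_sup; [exact: S0|exact: ubS].
lra.
Qed.

Let err_small v eps : 0 < eps -> \forall t \near 0^'+, err t v <= eps.
Proof. exact: small_ray. Qed.

(* [x + t *: (u + v)] is the midpoint of [x + (2 * t) *: u] and
   [x + (2 * t) *: v]. *)
Let L_add u v : L (u + v) = L u + L v.
Proof.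
apply/eqP; rewrite -subr_eq0 -normr_le0.
apply/ler_addgt0Pr => eps eps0; rewrite add0r.
have eps4 : 0 < eps / 4 by rewrite divr_gt0.
near (0 : R)^'+ => t.
have t0 : 0 < t by near: t; exact: nbhs_right_gt.
have t20 : 0 < t * 2 by rewrite mulr_gt0.
have h1 : err t (u + v) <= eps / 4 by near: t; exact: err_small.
have h2 : err t (u - v) <= eps / 4 by near: t; exact: err_small.
have err2 w : err t (2 *: w) <= eps / 4 -> err (t * 2) w <= eps / 4.
  rewrite /err normrZ ger0_norm// mulrA => /(le_trans _); apply.
  rewrite ler_wpM2l ?e_ge0 ?mulr_ge0 ?(ltW t0)// lef_pV2 ?posrE//.
  by rewrite ler_peMr ?(ltW t0)// ler1n.
have h3 : err (t * 2) u <= eps / 4 by apply: err2; near: t; exact: err_small.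
have h4 : err (t * 2) v <= eps / 4 by apply: err2; near: t; exact: err_small.
have : `|quot t (u + v) - (quot (t * 2) u + quot (t * 2) v)| <= err t (u - v).
  have l0 : (0 : R) <= 2^-1 by rewrite invr_ge0.
  have l1 : (2^-1 : R) <= 1 by lra.
  have uv : (2^-1 : R) *: (t *: (u - v)) + (1 - 2^-1) *: (t *: (v - u)) = 0.
    rewrite (_ : 1 - 2^-1 = 2^-1); last by field.
    by rewrite -!scalerDr addrA subrK subrr !scaler0.
  have := F_cvx (x + t *: (u + v)) l0 l1 uv.
  have := F_ccv (x + t *: (u + v)) l0 l1 uv.
  rewrite normrZ (gtr0_norm t0) normrZ (gtr0_norm t0) (distrC v u).
  rewrite (_ : x + t *: (u + v) + t *: (u - v) = x + (t * 2) *: u); last first.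
    by rewrite -addrA -scalerDr addrACA subrr addr0 -mulr2n -scaler_nat scalerA.
  rewrite (_ : x + t *: (u + v) + t *: (v - u) = x + (t * 2) *: v)
    => [/= h h'|]; last first.
    rewrite -addrA -scalerDr (addrC u) addrACA subrr addr0.
    by rewrite -mulr2n -scaler_nat scalerA.
  rewrite -(ler_pM2l t0) -{1}(gtr0_norm t0) -normrM /err.
  rewrite mulrCA divff ?gt_eqF// mulr1.
  rewrite (_ : t * (quot t (u + v) - _) =
    F (x + t *: (u + v)) - (2^-1 * F (x + (t * 2) *: u)
      + (1 - 2^-1) * F (x + (t * 2) *: v))); last first.
    by rewrite /quot; field; rewrite gt_eqF.
  by rewrite ler_norml; apply/andP; split; lra.
have := L_quot (u + v) t0; have := L_quot u t20; have := L_quot v t20.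
rewrite !ler_norml => /andP[? ?] /andP[? ?] /andP[? ?] /andP[? ?].
by apply/andP; split; lra.
Unshelve. all: by end_near. Qed.

Let L0 : L 0 = 0.
Proof. by apply: (addrI (L 0)); rewrite -L_add !addr0. Qed.

Let LN v : L (- v) = - L v.
Proof. by apply/eqP; rewrite -addr_eq0 -L_add addNr L0. Qed.

Let L_scale_gt0 c v : 0 < c -> L (c *: v) = c * L v.
Proof.
move=> c0.
apply/eqP; rewrite -subr_eq0 -normr_le0.
apply/ler_addgt0Pr => eps eps0; rewrite add0r.
have eps2 : 0 < eps / 2 by rewrite divr_gt0.
near (0 : R)^'+ => t.
have t0 : 0 < t by near: t; exact: nbhs_right_gt.
have tc0 : 0 < t * c by rewrite mulr_gt0.
have h : err t (c *: v) <= eps / 2 by near: t; exact: err_small.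
have := L_quot (c *: v) t0; have := L_quot v tc0.
rewrite -(ler_pM2l c0) -{1}(gtr0_norm c0) -normrM.
rewrite (_ : c * err (t * c) v = err t (c *: v)); last first.
  by rewrite /err normrZ gtr0_norm// -(mulrA t); field; rewrite !gt_eqF.
rewrite mulrBr (_ : c * quot (t * c) v = quot t (c *: v)); last first.
  by rewrite /quot scalerA; field; rewrite !gt_eqF.
rewrite !ler_norml => /andP[? ?] /andP[? ?].
by apply/andP; split; lra.
Unshelve. all: by end_near. Qed.

Let L_scale c v : L (c *: v) = c * L v.
Proof.
have [c0|c0|->] := ltgtP c 0; last by rewrite scale0r mul0r L0.
  have := @L_scale_gt0 (- c) v; rewrite oppr_gt0 scaleNr LN mulNr => /(_ c0).
  exact: oppr_inj.
exact: L_scale_gt0.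
Qed.

Let L_bounded : exists C, forall v, L v <= C * `|v|.
Proof.
have [K hK] := F_bound; exists (K - F x + e 1) => v.
have [->|v0] := eqVneq v 0; first by rewrite normr0 mulr0 L0.
have {}v0 : 0 < `|v| by rewrite normr_gt0.
pose w := `|v|^-1 *: v.
have w1 : `|w| = 1 by rewrite normrZ gtr0_norm ?invr_gt0// mulVf// gt_eqF.
have -> : v = `|v| *: w by rewrite scalerA divff ?gt_eqF// scale1r.
rewrite L_scale normrZ normr_id w1 mulr1 mulrC ler_wpM2r//.
have := L_quot w ltr01; rewrite /quot /err divr1 mul1r w1 scale1r divr1.
have := hK w ltac:(by rewrite w1); rewrite ler_norml => ? /andP[]; lra.
Qed.

(** The difference quotients along a ray differ by at most the sum of the errors
    [e (t * |v|) / t], so they converge to a limit [L v] that is within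
    [e |v|] of the increment [F (x + v) - F x]. Jensen's inequality at midpoints
    makes [L] additive, the bound on [F] makes it bounded. *)
Lemma taylor_of_almost_affine : exists l : X, forall v,
  `|F (x + v) - F x - inner l v| <= e `|v|.
Proof.
have [C LC] := L_bounded; have [l Ll] := riesz L_add L_scale LC.
exists l => v; rewrite -Ll distrC.
by have := L_quot v ltr01; rewrite /quot /err scale1r !divr1 mul1r.
Qed.

End differentiability.

(** * Gradients *)

Section gradient.
Context {R : realType} {X : hilbertType R}.
Implicit Types (F : X -> R) (x l : X).

Lemma gradE F x l : (forall h, 'd F x h = inner l h) -> grad F x = l.
Proof.
move=> Fl; apply: xget_unique => // v vF.
apply/eqP; rewrite -subr_eq0 -normr_eq0.
by rewrite -sqrf_eq0 -inner_normE innerBl -vF -Fl subrr.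
Qed.

Lemma inner_grad F x h : differentiable F x -> 'd F x h = inner (grad F x) h.
Proof.
move=> dF; suff [l lF] : exists l, forall h, 'd F x h = inner l h.
  by rewrite (gradE lF).
have /linear_boundedP : bounded_near ('d F x) (nbhs (0 : X)).
  by apply: continuous_linear_bounded; exact: diff_continuous.
move=> /pinfty_ex_gt0[C _ LC].
apply: (riesz (C := C)) => [u v|c u|u].
- exact: linearD.
- exact: linearZ.
- by rewrite (le_trans (ler_norm _)).
Qed.

Lemma differentiable_taylor F x l (e : R -> R) :
  (forall eps : R, 0 < eps ->
    exists2 d : R, 0 < d & forall t, 0 <= t -> t <= d -> e t <= eps * t) ->
  (forall v, `|F (x + v) - F x - inner l v| <= e `|v|) ->
  differentiable F x /\ grad F x = l.
Proof.
move=> e_small Fl.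
have il_lin : linear (inner l : X -> R^o).
  by move=> a u v; rewrite innerDr innerZr.
pose il : {linear X -> R^o} :=
  HB.pack (inner l : X -> R^o) (GRing.isLinear.Build _ _ _ _ _ il_lin).
have il_cont : continuous il.
  move=> y; apply/cvgrPdist_le => eps eps0; near=> z.
  rewrite /il/= -innerBr (le_trans (cauchy_schwarz_abs _ _))//.
  have l1 : 0 < `|l| + 1 by rewrite ltr_wpDl.
  have zy : `|y - z| <= eps / (`|l| + 1).
    by near: z; apply: cvgr_dist_le; [exact: cvg_id|rewrite divr_gt0].
  rewrite ler_pdivlMr// in zy.
  by rewrite (le_trans _ zy)// mulrC ler_wpM2l// lerDl.
have E : F \o shift x = cst (F x) + il +o_ (0 : X) id.
  apply/eqaddoP => eps eps0.
  have [d d0 hd] := e_small _ eps0.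
  near=> v; rewrite /= !fctE /= [v + x]addrC opprD addrA.
  rewrite (le_trans (Fl v))// hd//.
have D : forall h, 'd F x h = inner l h.
  by move=> h; rewrite (diff_unique il_cont E).
split; last exact: gradE.
by apply/diff_locallyP; rewrite (diff_unique il_cont E).
Unshelve. all: by end_near. Qed.

End gradient.

(** * Taylor expansions and continuity of the gradient *)

Section c1omega.
Context {R : realType} {X : hilbertType R} {omega : R -> R}.
Hypothesis homega : modulus_of_continuity omega.

Lemma modulus_small (eps : R) : 0 < eps ->
  exists2 d : R, 0 < d & forall t, 0 <= t -> t <= d -> omega t <= eps.
Proof.
move=> eps0.
have /subspace_continuousP/(_ (0 : R)) := modulus_continuous homega.
move=> /(_ ltac:(by rewrite /= in_itv/= lexx)) /cvgrPdist_le /(_ _ eps0).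
move=> /nbhs_ballP[d /= d0 hd]; exists (d / 2); first by rewrite divr_gt0.
move=> t t0 td; have : `|omega 0 - omega t| <= eps.
  apply: hd; last by rewrite /= in_itv/= t0.
  by rewrite -ball_normE/= sub0r normrN ger0_norm//; lra.
by rewrite (modulus0 homega) sub0r normrN; exact: le_trans (ler_norm _).
Qed.

Lemma phi_small (eps : R) : 0 < eps ->
  exists2 d : R, 0 < d & forall t, 0 <= t -> t <= d -> phi omega t <= eps * t.
Proof.
move=> /modulus_small[d d0 hd]; exists d => // t t0 td.
by rewrite (le_trans (phi_le_modulus homega t0))// mulrC ler_wpM2r// hd.
Qed.

(** Both sides are compared through their derivatives along the segment from [x]
    to [x + v]. *)
Lemma C1omega_taylor (C : R) (F : X -> R) (x v : X) : 
  (forall x, differentiable F x) ->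
  (forall x y, `|grad F x - grad F y| <= C * omega `|x - y|) ->
  `|F (x + v) - F x - inner (grad F x) v| <= C * phi omega `|v|.
Proof.
move=> dF gF.
have kP (t : R) : is_derive t (1 : R) (fun t : R => F (x + t *: v))
    (inner (grad F (x + t *: v)) v).
  have gr : (fun h : R => h^-1 *:
        (((fun t => F (x + t *: v)) \o shift t) (h *: 1) - F (x + t *: v))) =
      (fun h : R => h^-1 *:
        ((F \o shift (x + t *: v)) (h *: v) - F (x + t *: v))).
    by apply/funext => h /=; rewrite [_%:A]mulr1 scalerDl addrCA.
  have dv := diff_derivable (dF (x + t *: v)) (v := v).
  apply: DeriveDef; first by rewrite /derivable gr.
  by rewrite /derive gr -inner_grad// -deriveE.
(* The two bounds on the absolute value are the cases [s = 1] and [s = - 1]. *)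
have key (s : R) : `|s| = 1 ->
    s * (F (x + v) - F x - inner (grad F x) v) <= C * phi omega `|v|.
  move=> s1.
  have lP (t : R) : is_derive t (1 : R) (fun t : R => t * `|v|) `|v|.
    by apply: is_derive_eq; rewrite /GRing.scale/=; ring.
  pose h (t : R) := C * (phi omega \o (fun t => t * `|v|)) t
    - s * (F (x + t *: v) - t * inner (grad F x) v).
  pose dh (t : R) := C * (omega (Num.max (t * `|v|) 0) * `|v|)
    - s * (inner (grad F (x + t *: v)) v - inner (grad F x) v).
  have hP (t : R) : is_derive t (1 : R) h (dh t).
    have := kP t => ?.
    have := @is_derive1_comp R (phi omega) (fun t => t * `|v|) t _ _
      (phi_is_derive homega (t * `|v|)) (lP t) => ?.
    by rewrite /h; apply: is_derive_eq; rewrite /GRing.scale/= /dh; ring.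
  have : h 0 <= h 1.
    apply: (le_of_derive_ge0 ler01 hP) => t t0 _.
    rewrite /dh max_l ?mulr_ge0// subr_ge0 -innerBl.
    rewrite (le_trans (ler_norm _))// normrM s1 mul1r.
    rewrite (le_trans (cauchy_schwarz_abs _ _))// mulrA ler_wpM2r//.
    have := gF (x + t *: v) x.
    by rewrite addrAC subrr add0r normrZ ger0_norm.
  rewrite /h /= !mul0r scale0r addr0 !mul1r scale1r phi0; lra.
rewrite ler_norml -[leLHS]mulN1r; apply/andP; split.
  by have := key (-1) ltac:(by rewrite normrN1); lra.
by have := key 1 (normr1 _); lra.
Qed.

(** Let [z] be half of [x - y] and [v] be parallel to [g x - g y]. The
    expansions at [x] and [y], evaluated at the two points [(x + y) / 2 +- v],
    combine to [<g x - g y, v> <= M * (theta |v + z| + theta |v - z|)]. With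
    [d = |x - y|], [|v| = sqrt 15 / 2 * d] and [|z| = d / 2], the squares of
    [|v + z| / 2] and [|v - z| / 2] average to [d ^+ 2], so that concavity of
    [s |-> phi (sqrt s)] bounds the right-hand side by [8 * M * phi d]. *)
Lemma taylor_lipschitz (M : R) (F : X -> R) (g : X -> X) : 0 <= M ->
  (forall x v, `|F (x + v) - F x - inner (g x) v| <= M * theta omega `|v|) ->
  forall x y, `|g x - g y| <= 16 / Num.sqrt 15 * M * omega `|x - y|.
Proof.
move=> M0 Fg x y.
have [->|xy] := eqVneq x y.
  by rewrite !subrr normr0 (modulus0 homega) mulr0.
have d0 : 0 < `|x - y| by rewrite normr_gt0 subr_eq0.
have s0 : 0 < Num.sqrt 15 :> R by rewrite sqrtr_gt0.
have s2 : Num.sqrt 15 ^+ 2 = 15 :> R by rewrite sqr_sqrtr.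
set s := Num.sqrt 15 in s0 s2 *.
have [w0|w0] := eqVneq (g x - g y) 0.
  by rewrite w0 normr0 !mulr_ge0 ?invr_ge0 ?(modulus_ge0 homega)// ltW.
have {}w0 : 0 < `|g x - g y| by rewrite normr_gt0.
set w := g x - g y in w0 *; set d := `|x - y| in d0 *.
pose v := (s / 2 * d / `|w|) *: w; pose z := 2^-1 *: (x - y).
have nv : `|v| = s / 2 * d.
  rewrite normrZ ger0_norm ?divr_ge0 ?mulr_ge0 ?ltW// divfK ?gt_eqF//.
have nz : `|z| = d / 2 by rewrite normrZ ger0_norm ?invr_ge0// mulrC.
have wv : inner w v = s / 2 * d * `|w|.
  by rewrite innerZr inner_normE; field; rewrite gt_eqF.
have xE : x = y + z + z.
  rewrite /z -addrA -scalerDl (_ : 2^-1 + 2^-1 = 1) ?scale1r ?subrKC//.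
  by field.
have Fp1 := Fg x (v - z); have Fp2 := Fg y (v + z).
have Fq1 := Fg x (- (v + z)); have Fq2 := Fg y (z - v).
have ep : x + (v - z) = y + (v + z).
  by rewrite [in LHS]xE -addrA [z + _]addrCA subrr addr0 -addrA (addrC z).
have eq : x + - (v + z) = y + (z - v).
  by rewrite [in LHS]xE opprD addrACA subrr addr0 addrA.
rewrite ep in Fp1; rewrite eq normrN in Fq1; rewrite (distrC z) in Fq2.
have wv_le : inner w v <= M * (theta omega `|v + z| + theta omega `|v - z|).
  move: Fp1 Fp2 Fq1 Fq2; rewrite /w innerBl innerNr !innerBr !innerDr.
  by rewrite !ler_norml => /andP[? ?] /andP[? ?] /andP[? ?] /andP[? ?]; lra.
have theta_le :
    theta omega `|v + z| + theta omega `|v - z| <= 8 * (d * omega d).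
  have sq : (`|v + z| / 2) ^+ 2 + (`|v - z| / 2) ^+ 2 = 2 * d ^+ 2.
    rewrite !expr_div_n -mulrDl parallelogram nv nz !exprMn s2.
    by rewrite exprVn; field.
  have := phi_tangent_sqr homega d0 (divr_ge0 (normr_ge0 (v + z)) (ler0n R 2)).
  have := phi_tangent_sqr homega d0 (divr_ge0 (normr_ge0 (v - z)) (ler0n R 2)).
  have := phi_le_modulus homega (ltW d0).
  rewrite /theta; set c := omega d / _.
  have : c * ((`|v + z| / 2) ^+ 2 - d ^+ 2) +
         c * ((`|v - z| / 2) ^+ 2 - d ^+ 2) = 0.
    by rewrite -mulrDr addrACA sq; ring.
  lra.
have := ler_wpM2l M0 theta_le => /(le_trans wv_le); rewrite wv => h.
rewrite (_ : 16 / s * M * omega d = M * (8 * (d * omega d)) / (s / 2 * d));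
  last first.
  by field; rewrite !gt_eqF.
by rewrite ler_pdivlMr ?mulr_gt0// mulrC.
Qed.

End c1omega.

(** * The extension theorem *)

Section extension.
Context {R : realType} {X : hilbertType R} {omega : R -> R}.
Hypothesis homega : modulus_of_continuity omega.
Implicit Types (M : R) (E : set X) (f : X -> R) (G : X -> X).

(** The extension before its gradient estimate; the Taylor error [M * theta] is
    what [taylor_lipschitz] turns into the constant [16 / sqrt 15]. *)
Lemma mg1omega_extension M E f G :
  E !=set0 -> 0 < M -> mg1omega omega M E f G ->
  exists F : X -> R,
    [/\ forall x, differentiable F x,
        forall x v,
          `|F (x + v) - F x - inner (grad F x) v| <= M * theta omega `|v|
      & forall x, E x -> F x = f x /\ grad F x = G x].
Proof.
move=> [z0 Ez0] M0 mg.
pose e t := M * theta omega t.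
have M40 : 0 < 4 * M by rewrite mulr_gt0.
have e_eq0 : e 0 = 0 by rewrite /e /theta mul0r phi0 !mulr0.
have e_le s t : 0 <= s -> s <= t -> e s <= e t.
  move=> _ st; rewrite /e /theta ler_pM2l// ler_pM2l// phi_le//.
  by rewrite ler_pM2r ?invr_gt0.
have e_small (eps : R) : 0 < eps ->
    exists2 d : R, 0 < d & forall t, 0 <= t -> t <= d -> e t <= eps * t.
  move=> eps0; have [d d0 hd] := phi_small homega (divr_gt0 eps0 M40).
  exists d => // t t0 td.
  have := hd (t / 2) ltac:(lra) ltac:(lra).
  rewrite mulrAC ler_pdivlMr// /e /theta.
  have := mulr_ge0 (ltW eps0) t0; lra.
have Mphi_small (eps : R) : 0 < eps ->
    exists2 d : R, 0 < d &
      forall t, 0 <= t -> t <= d -> M * phi omega t <= eps * t.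
  move=> eps0; have [d d0 hd] := phi_small homega (divr_gt0 eps0 M0).
  exists d => // t t0 td.
  by have := hd t t0 td; rewrite mulrAC ler_pdivlMr// mulrC.
pose lower z x := f z + inner (G z) (x - z) - M * phi omega `|x - z|.
pose upper z x := f z + inner (G z) (x - z) + M * phi omega `|x - z|.
have lower_cvx z : almost_convex e (lower z).
  apply: subgradient_almost_convex => x.
  have [xi hxi] := phi_norm_taylor homega (x - z).
  exists (G z - M *: xi) => u.
  have := ler_wpM2l (ltW M0) (hxi u).
  rewrite /lower /e [x + u - z]addrAC innerBl innerZl !innerDr; lra.
have upper_ccv z : almost_convex e (\- upper z).
  apply: subgradient_almost_convex => x.
  have [xi hxi] := phi_norm_taylor homega (x - z).
  exists ((-1) *: G z - M *: xi) => u.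
  have := ler_wpM2l (ltW M0) (hxi u).
  rewrite /= /upper /e [x + u - z]addrAC innerBl !innerZl !innerDr; lra.
have [F [F_cvx F_ccv lowF Fup]] : exists F : X -> R,
    [/\ almost_convex e F, almost_convex e (\- F),
        forall p x, (lower @` E) p -> p x <= F x &
        forall q x, (upper @` E) q -> F x <= q x].
  apply: almost_convex_sandwich.
  - by exists (lower z0), z0.
  - by exists (upper z0), z0.
  - by move=> _ _ x [z Ez <-] [y Ey <-]; exact: mg.
  - by move=> _ [z _ <-].
  - by move=> _ [z _ <-].
have {}lowF z x : E z -> lower z x <= F x by move=> Ez; apply: lowF; exists z.
have {}Fup z x : E z -> F x <= upper z x by move=> Ez; apply: Fup; exists z.
have F_bound x : exists K, forall v, `|v| <= 1 -> F (x + v) <= K.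
  pose r := `|x - z0| + 1.
  exists (f z0 + `|G z0| * r + M * phi omega r) => v v1.
  have nr : `|x + v - z0| <= r.
    by rewrite addrAC (le_trans (ler_normD _ _))// lerD2l.
  apply: (le_trans (Fup z0 _ Ez0)); rewrite /upper !lerD//.
    by rewrite (le_trans (cauchy_schwarz _ _))// ler_wpM2l.
  by rewrite ler_pM2l// phi_le.
have F_taylor x :
    exists l, forall v, `|F (x + v) - F x - inner l v| <= e `|v|.
  exact: (taylor_of_almost_affine e_eq0 e_le e_small F_cvx F_ccv (F_bound x)).
exists F; split=> [x|x v|x Ex].
- by have [l /(differentiable_taylor e_small)[]] := F_taylor x.
- by have [l lF] := F_taylor x; have [_ ->] := differentiable_taylor e_small lF.
- have Fx : F x = f x.
    have := lowF x x Ex; have := Fup x x Ex.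
    by rewrite /upper /lower subrr normr0 phi0 inner0r; lra.
  split=> //; apply: (differentiable_taylor Mphi_small _).2 => v.
  have := lowF x (x + v) Ex; have := Fup x (x + v) Ex.
  rewrite /upper /lower Fx [x + v - x]addrAC subrr add0r ler_norml => ? ?.
  by apply/andP; split; lra.
Qed.

End extension.

Unset Implicit Arguments.

Theorem theorem1p5 (R : realType) (omega : R -> R)
    (homega : modulus_of_continuity omega)
    (X : hilbertType R) (E : set X) (E0 : E !=set0)
    (f : X -> R) (G : X -> X) :
  ((exists2 F : X -> R, C1omega omega F &
      forall x, E x -> F x = f x /\ grad F x = G x) <->
   (exists2 M : R, 0 < M & mg1omega omega M E f G)) /\
  (forall M : R, 0 < M -> mg1omega omega M E f G ->
    exists F : X -> R,
      [/\ C1omega omega F,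
          forall x, E x -> F x = f x /\ grad F x = G x &
          (Momega omega setT (grad F) <= (16 / Num.sqrt 15 * M)%:E)%E]).
Proof.
have extend M : 0 < M -> mg1omega omega M E f G -> exists F : X -> R,
    [/\ C1omega omega F, forall x, E x -> F x = f x /\ grad F x = G x &
        (Momega omega setT (grad F) <= (16 / Num.sqrt 15 * M)%:E)%E].
  move=> M0 /(mg1omega_extension homega E0 M0)[F [dF tF FE]].
  have lip := taylor_lipschitz homega (ltW M0) tF.
  have C0 : 0 < 16 / Num.sqrt 15 * M.
    by rewrite mulr_gt0// divr_gt0// sqrtr_gt0.
  exists F; split=> //; first by split=> //; exists (16 / Num.sqrt 15 * M).
  apply: ge_ereal_sup => _ [[x y] [_ _ /= xy] <-]; rewrite lee_fin.
  have := modulus_ge0 homega (normr_ge0 (x - y)).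
  rewrite le_eqVlt => /predU1P[<-|o0]; first by rewrite invr0 mulr0 ltW.
  by rewrite ler_pdivrMr.
split=> //; split=> [[F [dF [C C0 gF]] FE]|[M M0 /(extend _ M0)[F [? ? _]]]].
  exists C => // y z x Ey Ez.
  have [<- <-] := FE y Ey; have [<- <-] := FE z Ez.
  have := C1omega_taylor homega y (x - y) dF gF.
  have := C1omega_taylor homega z (x - z) dF gF.
  rewrite !subrKC !ler_norml => /andP[? ?] /andP[? ?]; lra.
by exists F.
Qed.
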